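(* There exist almost complex structures $J$ on $\mathbb{C}^2$ which agree with the standard complex structure $i$ outside of a compact set and have $h^-_J=0$.
   Context: An almost complex structure $J$ on a manifold $M$ is a smooth $(1,1)$-tensor field with $J^2=-\mathrm{id}$. A smooth real $2$-form $\alpha$ is $J$-anti-invariant if $\alpha(JX,JY)=-\alpha(X,Y)$ for all vector fields $X,Y$. $h^-_J$ denotes the dimension of the real vector space of closed $J$-anti-invariant $2$-forms on $(M,J)$. The standard complex structure $i$ on $\mathbb{C}^2$ is induced by multiplication by $i$. *)

(* Defs.v *)
From HB Require Import structures.
From mathcomp Require Import all_boot all_order all_algebra.
From mathcomp Require Import all_classical all_reals all_analysis.
From mathcomp Require Import complex.
Set Implicit Arguments.
Unset Strict Implicit.
Unset Printing Implicit Defensive.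
Import Order.TTheory GRing.Theory Num.Theory.
Import numFieldNormedType.Exports.
Local Open Scope classical_set_scope.
Local Open Scope ring_scope.

Definition partial (R : realType) (n : nat) (i : 'I_n.+1)
    (f : 'rV[R]_n.+1 -> R) : 'rV[R]_n.+1 -> R :=
  'D_(delta_mx 0 i) f.

(* C^oo: every iterated partial derivative exists and is continuous. *)
Definition smooth (R : realType) (n : nat) (f : 'rV[R]_n.+1 -> R) : Prop :=
  forall s : seq 'I_n.+1,
    let g := foldr (@partial R n) f s in
    continuous g /\ forall (i : 'I_n.+1) x, derivable g x (delta_mx 0 i).

Definition smooth_mx (R : realType) (n p q : nat)
    (F : 'rV[R]_n.+1 -> 'M[R]_(p, q)) : Prop :=
  forall i j, smooth (fun x => F x i j).

(* A (1,1)-tensor field on R^n is a matrix-valued function acting on tangent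
   vectors (rows) on the right: (J X)(x) = X x *m J x. *)
Definition almost_complex (R : realType) (n : nat)
    (J : 'rV[R]_n.+1 -> 'M[R]_n.+1) : Prop :=
  smooth_mx J /\ forall x, J x *m J x = - 1%:M.

(* A 2-form on R^n is given by its matrix of components
   a x i j = a_x(e_i, e_j). *)
Definition two_form (R : realType) (n : nat)
    (a : 'rV[R]_n.+1 -> 'M[R]_n.+1) : Prop :=
  smooth_mx a /\ forall x, (a x)^T = - a x.

Definition form_eval (R : realType) (n : nat) (A : 'M[R]_n) (u v : 'rV[R]_n)
    : R :=
  (u *m A *m v^T) 0 0.

Definition anti_invariant (R : realType) (n : nat)
    (J a : 'rV[R]_n.+1 -> 'M[R]_n.+1) : Prop :=
  forall X Y : 'rV[R]_n.+1 -> 'rV[R]_n.+1, smooth_mx X -> smooth_mx Y ->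
  forall x,
    form_eval (a x) (X x *m J x) (Y x *m J x) = - form_eval (a x) (X x) (Y x).

(* (d a)(e_i, e_j, e_k) *)
Definition ext_deriv (R : realType) (n : nat)
    (a : 'rV[R]_n.+1 -> 'M[R]_n.+1) (i j k : 'I_n.+1) (x : 'rV[R]_n.+1) : R :=
  partial i (fun y => a y j k) x + partial j (fun y => a y k i) x
  + partial k (fun y => a y i j) x.

Definition closed_form (R : realType) (n : nat)
    (a : 'rV[R]_n.+1 -> 'M[R]_n.+1) : Prop :=
  forall i j k x, ext_deriv a i j k x = 0.

Definition closed_anti_invariant (R : realType) (n : nat)
    (J : 'rV[R]_n.+1 -> 'M[R]_n.+1) : set ('rV[R]_n.+1 -> 'M[R]_n.+1) :=
  [set a | [/\ two_form a, closed_form a & anti_invariant J a]].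

(* W is a linear subspace of V with a basis of d vectors. *)
Definition has_dim (R : realType) (V : lmodType R) (W : set V) (d : nat)
    : Prop :=
  exists b : 'I_d -> V,
    (forall c : 'I_d -> R, \sum_(i < d) c i *: b i = 0 -> forall i, c i = 0) /\
    (forall w, W w <-> exists c : 'I_d -> R, w = \sum_(i < d) c i *: b i).

(* h_J^- = d *)
Definition h_minus_eq (R : realType) (n : nat)
    (J : 'rV[R]_n.+1 -> 'M[R]_n.+1) (d : nat) : Prop :=
  has_dim (closed_anti_invariant J) d.

(* C^2 as R^4 with coordinates (x_1, y_1, x_2, y_2), z_k = x_k + i y_k. *)
Definition toC2 (R : realType) (v : 'rV[R]_4) : 'rV[R[i]]_2 :=
  \row_(k < 2) (v 0 (inord k.*2) +i* v 0 (inord k.*2.+1))%C.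

Definition ofC2 (R : realType) (z : 'rV[R[i]]_2) : 'rV[R]_4 :=
  \row_(j < 4) let zk := z 0 (inord j./2) in
    if odd j then complex.Im zk else complex.Re zk.

Definition std_J (R : realType) : 'M[R]_4 :=
  lin1_mx (fun v : 'rV[R]_4 => ofC2 ('i%C *: toC2 v)).

Lemma toC2K (R : realType) : cancel (@toC2 R) (@ofC2 R).
Proof.
move=> v; apply/rowP => j; rewrite !mxE.
have Hj : (j./2 < 2)%N by case: j => [[|[|[|[|]]]]].
rewrite inordK //=.
case: ifP => oj; congr (v 0 _); apply: val_inj; rewrite /= inordK;
  by case: j oj {Hj} => [[|[|[|[|]]]]].
Qed.

Lemma ofC2K (R : realType) : cancel (@ofC2 R) (@toC2 R).
Proof.
move=> z; apply/rowP => k; rewrite !mxE.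
have Hk := ltn_ord k.
have H0 : (k.*2 < 4)%N by rewrite -[4%N]/(2.*2) ltn_double.
have H1 : (k.*2.+1 < 4)%N by rewrite -[4%N]/(2.*2) ltn_Sdouble.
rewrite !inordK //= odd_double /= doubleK uphalf_double inord_val.
by case: (z 0 k).
Qed.

(* On tangent vectors, std_J is multiplication by i. *)
Lemma std_JE (R : realType) (v : 'rV[R]_4) :
  toC2 (v *m std_J R) = 'i%C *: toC2 v.
Proof.
pose f (v : 'rV[R]_4) := ofC2 ('i%C *: toC2 v).
have lf : linear f.
  move=> a u w; apply/rowP => j; rewrite !mxE /=.
  by case: ifP => _; rewrite /= ?mul0r ?mul1r ?sub0r ?add0r ?addr0 // opprD mulrN.
pose F : {linear 'rV[R]_4 -> 'rV[R]_4} :=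
  HB.pack f (GRing.isLinear.Build R _ _ _ f lf).
suff -> : v *m std_J R = F v by rewrite ofC2K.
by rewrite -(mul_rV_lin1 F).
Qed.

(* Main.v *)
Require Import Defs.
From mathcomp Require Import all_boot all_order all_algebra.
From mathcomp Require Import all_classical all_reals all_analysis.
From mathcomp Require Import ring lra.
Import numFieldNormedType.Exports.
Local Open Scope classical_set_scope.
Local Open Scope ring_scope.

(** Let g be a smooth complex function with compact support on C^2, and let J be
    the almost complex structure whose (1,0)-forms are spanned by dz1 and
    dz2 + g d(conj z1). It is standard where g vanishes. Every J-anti-invariant
    form is the real part of f dz1 /\ (dz2 + g d(conj z1)) for a complex function
    f, and its closedness amounts to the two equations
      df / d(conj z2) = 0   and   df / d(conj z1) = d(2i Im(f g)) / dz2.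
    Applying d/d(conj z2) to the second one shows that Im(f g) is harmonic in z2.
    Its support is compact, hence it vanishes by the maximum principle
    ([harmonic_compact_support]). So f is holomorphic on C^2 and Im(f g) = 0: where
    g does not vanish, the values of f lie on a prescribed real line.

    For 2 g = rho (1 + i h), with rho positive exactly on the unit ball and
    h = x1 + 2, the Cauchy-Riemann equations in z1 together with this constraint
    determine the gradient of f in terms of f; the symmetry of second derivatives
    ([partialC]) is incompatible with them unless f = 0 on the ball
    ([local_vanishing]). The identity theorem, used in z2 and then in z1, gives
    f = 0 everywhere ([vanishing_from_ball]).

    The identity theorem also comes from the maximum principle, so that no
    integration is involved: if f vanishes near 0, then f / z^n has no singularity,
    and comparing |f / z^n|^2 with its values on the boundary of a square for all n
    forces f = 0 inside ([holo_identity]). *)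

Set Implicit Arguments.
Unset Strict Implicit.
Unset Printing Implicit Defensive.
Import Order.TTheory GRing.Theory Num.Theory.

(** * Directional derivatives and smooth functions *)

(** A directional derivative is an ordinary derivative along a line; this is how
    the one-variable theorems (chain rule, mean value, extrema) get applied. *)
Lemma is_derive_line (R : realType) (V : normedModType R) (f : V -> R)
    (x v : V) (t df : R) :
  is_derive (x + t *: v) v f df <-> is_derive t 1 (fun h => f (x + h *: v)) df.
Proof.
have E : (fun h : R => h^-1 *: ((f \o shift (x + t *: v)) (h *: v)
                                - f (x + t *: v))) =
  (fun h => h^-1 *: (((fun s => f (x + s *: v)) \o shift t) (h *: 1)
                     - f (x + t *: v))).
  apply/funext => h /=; rewrite [h *: 1]mulr1 scalerDl.
  by rewrite addrCA addrA.
by split=> -[d l]; constructor; move: d l; rewrite /derivable /derive E.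
Qed.

Lemma is_derive_chain (R : realType) (V : normedModType R) (f : V -> R)
    (g : R -> R) (x v : V) (df dg : R) :
  is_derive x v f df -> is_derive (f x) 1 g dg ->
  is_derive x v (fun y => g (f y)) (dg * df).
Proof.
move=> fx gx.
have /is_derive_line f0 : is_derive (x + 0 *: v) v f df.
  by rewrite scale0r addr0.
have -> : x = x + 0 *: v by rewrite scale0r addr0.
apply/(is_derive_line (fun y => g (f y))).
apply: (@is_derive1_comp _ g (fun h => f (x + h *: v))).
by rewrite scale0r addr0.
Qed.

(** The product, sum and difference rules in a form where the functions are
    lambda-terms and the expected derivative is left to an equation, so that a
    ring identity closes each computation. *)
Lemma is_deriveM_eq (R : realType) (V : normedModType R) (f g : V -> R)
    (x w : V) (df dg e : R) :
  is_derive x w f df -> is_derive x w g dg -> f x * dg + g x * df = e ->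
  is_derive x w (fun y => f y * g y) e.
Proof. by move=> Df Dg <-; exact: (is_deriveM Df Dg). Qed.

Lemma is_deriveD_eq (R : realType) (V : normedModType R) (f g : V -> R)
    (x w : V) (df dg e : R) :
  is_derive x w f df -> is_derive x w g dg -> df + dg = e ->
  is_derive x w (fun y => f y + g y) e.
Proof. by move=> Df Dg <-; exact: (is_deriveD Df Dg). Qed.

Lemma is_deriveB_eq (R : realType) (V : normedModType R) (f g : V -> R)
    (x w : V) (df dg e : R) :
  is_derive x w f df -> is_derive x w g dg -> df - dg = e ->
  is_derive x w (fun y => f y - g y) e.
Proof. by move=> Df Dg <-; exact: (is_deriveB Df Dg). Qed.

Section smooth_functions.
Variables (R : realType) (n : nat).
Implicit Types (f g : 'rV[R]_n.+1 -> R) (x : 'rV[R]_n.+1) (i j : 'I_n.+1).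

Local Notation e i := (delta_mx 0 i : 'rV[R]_n.+1).

Lemma smooth_continuous f : smooth f -> continuous f.
Proof. by move=> /(_ [::]) []. Qed.

Lemma smooth_is_derive f i x : smooth f -> is_derive x (e i) f (partial i f x).
Proof. by move=> /(_ [::]) [_ d]; apply: DeriveDef. Qed.

Lemma smooth_partial f i : smooth f -> smooth (partial i f).
Proof. by move=> sf s; rewrite -foldr_rcons; apply: sf. Qed.

(** Smoothness by coinduction: any family of continuous functions stable under
    partial differentiation consists of smooth functions. *)
Lemma smooth_coind (C : set ('rV[R]_n.+1 -> R)) :
  (forall f, C f -> continuous f /\ forall i, exists2 df, C df &
    forall x, is_derive x (e i) f (df x)) ->
  forall f, C f -> smooth f.
Proof.
move=> Cstep f Cf s.
have : C (foldr (@partial R n) f s).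
  elim: s => //= i s /Cstep [_ /(_ i) [df Cdf D]].
  suff -> : partial i (foldr (@partial R n) f s) = df by [].
  by apply/funext => x; apply: derive_val.
move=> /Cstep [? D]; split=> // i x.
by have [df _ /(_ x) []] := D i.
Qed.

Lemma smooth_line f i x (t : R) : smooth f ->
  is_derive t 1 (fun h => f (x + h *: e i)) (partial i f (x + t *: e i)).
Proof. by move=> sf; apply/(is_derive_line f x (e i) t); exact: smooth_is_derive. Qed.

Lemma partialN f i x :
  smooth f -> partial i (fun z => - f z) x = - partial i f x.
Proof. by move=> /(smooth_is_derive i x) D; have [_ <-] := is_deriveN D. Qed.

Lemma partialD f g i x :
  smooth f -> smooth g ->
  partial i (fun z => f z + g z) x = partial i f x + partial i g x.
Proof.
move=> /(smooth_is_derive i x) Df /(smooth_is_derive i x) Dg.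
by have [_ <-] := is_deriveD Df Dg.
Qed.

Lemma partialB f g i x :
  smooth f -> smooth g ->
  partial i (fun z => f z - g z) x = partial i f x - partial i g x.
Proof.
move=> /(smooth_is_derive i x) Df /(smooth_is_derive i x) Dg.
by have [_ <-] := is_deriveB Df Dg.
Qed.

Lemma partial0 i x : partial i (fun=> 0) x = 0.
Proof. exact: derive_cst. Qed.

Lemma near_eq_partial f g i x : (\near x, f x = g x) -> partial i f x = partial i g x.
Proof. exact: near_eq_derive. Qed.

End smooth_functions.

(** * Smooth functions built from exp(-1/t) *)

Section flat.
Variable R : realType.

(** All derivatives of exp(-1/t), extended by 0 for t <= 0, are integer
    combinations of the functions t^(-n) exp(-1/t); the exponent n is a
    parameter so that the family is closed under differentiation. *)
Definition flat (n : nat) (t : R) : R :=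
  if 0 < t then t ^- n * expR (- t^-1) else 0.

(** From exp(1/t) >= (1/t)^(n+2) / (n+2)!. The quadratic order at 0 is what
    makes the derivative at the origin exist and vanish. *)
Lemma flat_bound n (t : R) : `|flat n t| <= n.+2`!%:R * t ^+ 2.
Proof.
rewrite /flat; case: ifP => t0; last by rewrite normr0 mulr_ge0 ?sqr_ge0.
have tn : 0 < t ^+ n by rewrite exprn_gt0.
rewrite ger0_norm ?mulr_ge0 ?expR_ge0 ?invr_ge0 ?(ltW tn)//.
rewrite expRN -invfM invf_ple ?posrE ?mulr_gt0 ?expR_gt0 ?exprn_gt0 ?ltr0n ?fact_gt0//.
have /(expR_ge1Dxn n.+1) : 0 <= t^-1 by rewrite invr_ge0 ltW.
set X := expR _ => H.
have {}H : t^-1 ^+ n.+2 / n.+2`!%:R <= X by apply: le_trans H; rewrite lerDr.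
apply: le_trans (ler_wpM2l (ltW tn) H).
have F0 : n.+2`!%:R != 0 :> R by rewrite pnatr_eq0 -lt0n fact_gt0.
suff -> : (n.+2`!%:R * t ^+ 2)^-1 = t ^+ n * (t^-1 ^+ n.+2 / n.+2`!%:R) by [].
by rewrite exprVn -[in t ^+ n.+2]addn2 exprD; field; rewrite F0 expf_neq0 gt_eqF.
Qed.

Lemma flat_gt0 n (t : R) : 0 < t -> 0 < flat n t.
Proof. by move=> t0; rewrite /flat t0 mulr_gt0 ?expR_gt0 ?invr_gt0 ?exprn_gt0. Qed.

Lemma flat_le0 n (t : R) : t <= 0 -> flat n t = 0.
Proof. by move=> t0; rewrite /flat ltNge t0. Qed.

Lemma is_derive_flat n (t : R) :
  is_derive t 1 (flat n) (flat n.+2 t - n%:R * flat n.+1 t).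
Proof.
have [t0|t0|->] := ltgtP t 0.
- rewrite !flat_le0 ?ltW// mulr0 subr0.
  apply: (@near_eq_is_derive _ _ _ (cst 0)).
  near=> s; rewrite flat_le0//; apply: ltW.
  by near: s; apply: lt_nbhsl.
- have tn0 : t != 0 by rewrite gt_eqF.
  have D1 : is_derive t 1 (fun s : R => s^-1) (- t ^- 2).
    apply: DeriveDef; first exact: derivableV.
    by rewrite deriveV// derive_id [_ *: _]mulr1.
  have D2 : is_derive t 1 (fun s => expR (- s^-1)) (expR (- t^-1) * t ^- 2).
    apply: is_derive_chain; rewrite -[t ^- 2]opprK.
    exact: is_deriveN.
  have D3 : is_derive t 1 (fun s : R => (s^-1) ^+ n) (- n%:R * t ^- n.+1).
    have -> : (fun s : R => s^-1 ^+ n) = (fun s : R => s^-1) ^+ n.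
      by rewrite exprfctE.
    apply: is_derive_eq.
    rewrite /GRing.scale/= -!exprVn; case: (n) => [|m]; first by rewrite !mul0r oppr0 mul0r.
    by rewrite /= mulrN mulNr -!mulrA -exprD addn2.
  have D : is_derive t 1 (fun s : R => s ^- n * expR (- s^-1))
      (flat n.+2 t - n%:R * flat n.+1 t).
    have -> : (fun s : R => s ^- n * expR (- s^-1)) =
        (fun s => s^-1 ^+ n) * (fun s => expR (- s^-1)).
      by apply/funext => s; rewrite [in RHS]/GRing.mul/= exprVn.
    apply: is_derive_eq.
    by rewrite /GRing.scale/= /flat t0 -!exprVn !exprS; ring.
  apply: near_eq_is_derive D.
  by near=> s; rewrite /flat ifT//; near: s; apply: lt_nbhsr.
- have F0 m : flat m 0 = 0 by apply: flat_le0.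
  rewrite !F0 mulr0 subr0.
  have C : (fun h : R => h^-1 *: ((flat n \o shift 0) (h *: 1) - flat n 0)) @ 0^' --> (0 : R).
    apply/cvgr0Pnorm_le => eps eps0.
    near=> h.
    rewrite /= F0 subr0 addr0 [h *: 1]mulr1 normrM.
    have h0 : h != 0 by near: h; apply: nbhs_dnbhs_neq.
    apply: (le_trans (ler_wpM2l _ (flat_bound _ _))) => //.
    rewrite -[h ^+ 2]real_normK ?num_real// normfV.
    have -> : `|h|^-1 * (n.+2`!%:R * `|h| ^+ 2) = n.+2`!%:R * `|h|.
      by field; rewrite normr_eq0.
    rewrite -ler_pdivlMl ?ltr0n ?fact_gt0//.
    near: h; apply: nbhs_dnbhs.
    exists (n.+2`!%:R^-1 * eps) => /=.
      by rewrite mulr_gt0 ?invr_gt0 ?ltr0n ?fact_gt0.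
    by move=> y; rewrite /= sub0r normrN => /ltW.
  apply: DeriveDef; first by apply/cvg_ex; exists 0.
  exact: cvg_lim C.
Unshelve. all: by end_near.
Qed.

Lemma continuous_flat n : continuous (flat n).
Proof.
move=> t; apply/differentiable_continuous/derivable1_diffP.
by have [] := is_derive_flat n t.
Qed.

End flat.

Section elementary.
Variables (R : realType) (n : nat).
Local Notation e i := (delta_mx 0 i : 'rV[R]_n.+1).

(** A syntactic class stable under partial differentiation, large enough for the
    entries of the almost complex structure. *)
Inductive elementary : ('rV[R]_n.+1 -> R) -> Prop :=
| elementary_cst c : elementary (fun=> c)
| elementary_coord i : elementary (fun x => x 0 i)
| elementaryD f g : elementary f -> elementary g ->
    elementary (fun x => f x + g x)
| elementaryM f g : elementary f -> elementary g ->
    elementary (fun x => f x * g x)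
| elementary_flat k f : elementary f -> elementary (fun x => flat k (f x)).

Lemma is_derive_coord i (x v : 'rV[R]_n.+1) :
  is_derive x v (fun y : 'rV[R]_n.+1 => y 0 i) (v 0 i).
Proof.
have -> : x = x + 0 *: v by rewrite scale0r addr0.
apply/(is_derive_line (fun y : 'rV[R]_n.+1 => y 0 i)).
have -> : (fun h : R => (x + h *: v) 0 i) = cst (x 0 i) + (fun h => h * v 0 i).
  by apply/funext => h; rewrite !mxE.
have -> : (fun h : R => h * v 0 i) = id * cst (v 0 i) by [].
by apply: is_derive_eq; rewrite /GRing.scale/= add0r mulr0 add0r mulr1.
Qed.

Lemma elementary_smooth f : elementary f -> smooth f.
Proof.
apply: smooth_coind => {}f; elim=> {f}.
- move=> c; split; first exact: cst_continuous.
  move=> i; exists (fun=> 0); first exact: elementary_cst.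
  by move=> x; exact: is_derive_cst.
- move=> j; split; first exact: coord_continuous.
  move=> i; exists (fun=> (e i) 0 j); first exact: elementary_cst.
  by move=> x; exact: is_derive_coord.
- move=> f g ef [cf df] eg [cg dg]; split.
    by move=> x; apply: (@continuousD _ _ _ f g); [exact: cf|exact: cg].
  move=> i; have [f' ef' df'] := df i; have [g' eg' dg'] := dg i.
  exists (fun x => f' x + g' x); first exact: elementaryD.
  by move=> x; apply: is_deriveD.
- move=> f g ef [cf df] eg [cg dg]; split.
    by move=> x; apply: (@continuousM _ _ f g); [exact: cf|exact: cg].
  move=> i; have [f' ef' df'] := df i; have [g' eg' dg'] := dg i.
  exists (fun x => f x * g' x + g x * f' x).
    by apply: elementaryD; apply: elementaryM.
  by move=> x; apply: is_deriveM.
- move=> k f ef [cf df]; split.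
    by move=> x; apply: continuous_comp; [exact: cf|exact: continuous_flat].
  move=> i; have [f' ef' df'] := df i.
  exists (fun x => (flat k.+2 (f x) + (- k%:R) * flat k.+1 (f x)) * f' x).
    apply: elementaryM => //; apply: elementaryD; first exact: elementary_flat.
    by apply: elementaryM; [exact: elementary_cst|exact: elementary_flat].
  move=> x; apply: is_derive_chain; rewrite mulNr; exact: is_derive_flat.
Qed.

End elementary.

(** * Symmetry of second partial derivatives *)

Lemma MVT_everywhere (R : realType) (g dg : R -> R) (a : R) : 0 < a ->
  (forall t : R, is_derive t 1 g (dg t)) ->
  exists2 c, 0 < c < a & g a - g 0 = dg c * a.
Proof.
move=> a0 D; have [|c ca E] := MVT a0 (fun (t : R) _ => D t).
  apply: continuous_subspaceT => t; apply: differentiable_continuous.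
  by apply/derivable1_diffP; have [] := D t.
by exists c; [rewrite in_itv/= in ca|rewrite E subr0].
Qed.

Section schwarz.
Variables (R : realType) (n : nat).
Implicit Types (f : 'rV[R]_n.+1 -> R) (x : 'rV[R]_n.+1) (i j : 'I_n.+1).
Local Notation e i := (delta_mx 0 i : 'rV[R]_n.+1).

Lemma norm_delta_le1 i : `|e i| <= 1.
Proof.
rewrite [leLHS]/Num.norm/= mx_normrE; apply: bigmax_le => // -[k l] _ /=.
by rewrite mxE; case: (_ && _); rewrite /= ?normr1 ?normr0.
Qed.

(** Applying the mean value theorem first in direction i to the increment of f
    in direction j, then in direction j. The left-hand side is symmetric in i
    and j, which is the reason why mixed partial derivatives agree. *)
Lemma double_increment f i j x (a : R) : smooth f -> 0 < a ->
  exists c d : R, [/\ 0 < c < a, 0 < d < a &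
    f (x + a *: e i + a *: e j) - f (x + a *: e i) - f (x + a *: e j) + f x =
    partial j (partial i f) (x + c *: e i + d *: e j) * a * a].
Proof.
move=> sf a0.
pose g t := f (x + a *: e j + t *: e i) - f (x + t *: e i).
have Dg (t : R) : is_derive t 1 g
    (partial i f (x + a *: e j + t *: e i) - partial i f (x + t *: e i)).
  by apply: is_deriveB; apply: smooth_line.
have [c ca Ec] := MVT_everywhere a0 Dg.
have [d da Ed] := MVT_everywhere a0
  (fun t : R => smooth_line j (x + c *: e i) t (smooth_partial i sf)).
exists c, d; split=> //; rewrite -Ed scale0r addr0.
rewrite [x + c *: e i + a *: e j]addrAC -Ec /g scale0r !addr0.
rewrite [x + a *: e j + a *: e i]addrAC; ring.
Qed.

(** The two mixed derivatives take a common value at two points that tend to x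
    with the side of the square; continuity concludes. *)
Lemma partialC f i j x : smooth f ->
  partial i (partial j f) x = partial j (partial i f) x.
Proof.
move=> sf; set p := partial i (partial j f); set q := partial j (partial i f).
have cp : continuous p by apply/smooth_continuous/smooth_partial/smooth_partial.
have cq : continuous q by apply/smooth_continuous/smooth_partial/smooth_partial.
apply/eqP; rewrite -subr_eq0 -normr_le0; apply/ler_addgt0Pl => eps eps0.
rewrite addr0.
have eps20 : 0 < eps / 2 by rewrite divr_gt0.
have /cvgrPdist_le/(_ _ eps20) := cp x.
have /cvgrPdist_le/(_ _ eps20) := cq x.
move=> /nbhs_ballP[r1 /= r10 B1] /nbhs_ballP[r2 /= r20 B2].
pose a := Num.min r1 r2 / 2.
have a0 : 0 < a by rewrite divr_gt0// lt_min r10.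
have ball_close k l (c d r : R) : a + a <= r -> 0 < c < a -> 0 < d < a ->
    ball x r (x + c *: e k + d *: e l).
  move=> ar /andP[c0 ca] /andP[d0 da].
  rewrite -ball_normE/= -addrA opprD addNKr normrN.
  apply: le_lt_trans (ler_normD _ _) _; rewrite !normrZ !gtr0_norm//.
  have := ler_wpM2l (ltW c0) (norm_delta_le1 k).
  have := ler_wpM2l (ltW d0) (norm_delta_le1 l).
  move: ar ca da; set ek := `|_|; set el := `|_|; lra.
have [ar1 ar2] : a + a <= r1 /\ a + a <= r2.
  have -> : a + a = Num.min r1 r2 by rewrite /a; field.
  by split; rewrite ge_min lexx ?orbT.
clearbody a.
have [c [d [hc hd E1]]] := double_increment i j x sf a0.
have [c' [d' [hc' hd' E2]]] := double_increment j i x sf a0.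
have /B1 /= Q1 := ball_close i j c d r1 ar1 hc hd.
have /B2 /= Q2 := ball_close j i c' d' r2 ar2 hc' hd'.
(* Both increments are the same combination of the four values of f. *)
have EE : q (x + c *: e i + d *: e j) = p (x + c' *: e j + d' *: e i).
  have aa0 : a * a != 0 by rewrite mulf_neq0// gt_eqF.
  have H : q (x + c *: e i + d *: e j) * a * a =
      p (x + c' *: e j + d' *: e i) * a * a.
    rewrite [LHS](esym E1) [RHS](esym E2).
    rewrite [x + a *: e j + a *: e i]addrAC.
    set u1 := f _; set u2 := f (_ + _); set u3 := f (_ + _).
    by rewrite -!addrA; congr (_ + _); rewrite addrCA.
  move: H; generalize (q (x + c *: e i + d *: e j)) => Q.
  generalize (p (x + c' *: e j + d' *: e i)) => P.
  by rewrite -!mulrA => /(mulIf aa0).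
clear E1 E2; clearbody p q.
have := ler_normB (p x - p (x + c' *: e j + d' *: e i))
  (q x - q (x + c *: e i + d *: e j)).
have -> : p x - p (x + c' *: e j + d' *: e i) -
    (q x - q (x + c *: e i + d *: e j)) = p x - q x.
  by rewrite EE; ring.
by move: Q1 Q2; set A := `|_|; set B := `|_|; set C := `|_|; lra.
Qed.

End schwarz.

(** * The maximum principle on squares *)

Section planar.
Variable R : realType.
Implicit Types (s t : R) (W u v : R -> R -> R).

(** If c were positive, df, which vanishes at t0, would be positive just to the
    right of t0, and f would exceed f t0 there by the mean value theorem. *)
Lemma second_derivative_test (f df : R -> R) (t0 c : R) :
  (\forall t \near t0, is_derive t (1 : R) f (df t)) ->
  (\forall t \near t0, f t <= f t0) ->
  is_derive t0 1 df c -> c <= 0.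
Proof.
move=> Df fmax Ddf.
have nb : \forall t \near t0, is_derive t (1 : R) f (df t) /\ f t <= f t0.
  by apply: filterI Df fmax.
have /nbhs_ballP[r /= r0 B] := nb.
have Bd t : t \in `]t0 - r, t0 + r[ -> is_derive t (1 : R) f (df t) /\ f t <= f t0.
  by rewrite in_itv/= => /andP[? ?]; apply: B; rewrite /ball/= ltr_norml; lra.
have mid : t0 \in `]t0 - r, t0 + r[ by rewrite in_itv/=; lra.
have df0 : df t0 = 0.
  have D1 : is_derive t0 1 f 0.
    apply: (@derive1_at_max _ f (t0 - r) (t0 + r)) => //; first lra.
      by move=> t /Bd[[]].
    by move=> t /Bd[].
  by have [[_ <-] _] := Bd _ mid; rewrite derive_val.
rewrite leNgt; apply/negP => c0.
have [dl dv] := Ddf.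
have : (fun h : R => h^-1 *: ((df \o shift t0) (h *: 1) - df t0)) @ 0^' --> c.
  by rewrite -dv; exact: dl.
move/(cvgr_gt c)/(_ _ c0) => [r1 /= r10 B1].
have dfpos h : 0 < h < r1 -> 0 < df (t0 + h).
  move=> /andP[h0 hr].
  have /= := B1 h; rewrite sub0r normrN gtr0_norm// => /(_ hr).
  rewrite gt_eqF// => /(_ isT); rewrite df0 subr0 [h *: 1]mulr1 addrC.
  by rewrite /GRing.scale/= pmulr_rgt0 ?invr_gt0.
pose h := Num.min r r1 / 2.
have h0 : 0 < h by rewrite divr_gt0// lt_min r0.
have [hr hr1] : h < r /\ h < r1.
  have : h + h = Num.min r r1 by rewrite /h; field.
  have : Num.min r r1 <= r by rewrite ge_min lexx.
  have : Num.min r r1 <= r1 by rewrite ge_min lexx orbT.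
  by split; lra.
have Bd' t : t0 <= t <= t0 + h -> is_derive t (1 : R) f (df t) /\ f t <= f t0.
  by move=> /andP[? ?]; apply: Bd; rewrite in_itv/=; lra.
have Df' t : t \in `]t0, t0 + h[ -> is_derive t (1 : R) f (df t).
  by rewrite in_itv/= => tin; apply: (Bd' t _).1; lra.
have cf : {within `[t0, t0 + h], continuous f}.
  by apply: derivable_within_continuous => t; rewrite in_itv/= => /Bd'[[]].
have [|t tin E] := MVT _ Df' cf; first lra.
have [_ le1] : is_derive (t0 + h) (1 : R) f (df (t0 + h)) /\ f (t0 + h) <= f t0.
  by apply: Bd'; lra.
have : 0 < df t * (t0 + h - t0).
  rewrite mulr_gt0//; last lra.
  have -> : t = t0 + (t - t0) by lra.
  by apply: dfpos; rewrite in_itv/= in tin; lra.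
by rewrite -E; lra.
Qed.

(** The Laplacian at (s, t) exists and is nonnegative. The first derivatives are
    only asked for near the point, along the two coordinate lines, because the
    principle below is applied to functions that are smooth only where they are
    positive. *)
Definition subharmonic_at W s t := exists Wx Wy : R -> R, exists wxx wyy : R,
  [/\ (\forall s' \near s, is_derive s' (1 : R) (W^~ t) (Wx s')),
      is_derive s 1 Wx wxx,
      (\forall t' \near t, is_derive t' (1 : R) (W s) (Wy t')),
      is_derive t 1 Wy wyy
    & 0 <= wxx + wyy].

Lemma compact_square (A : R) :
  compact [set p : R * R | `|p.1| <= A /\ `|p.2| <= A].
Proof.
rewrite (_ : mkset _ = `[- A, A] `*` `[- A, A]).
  by apply: compact_setX; exact: segment_compact.
by apply/seteqP; split => -[s t] /=; rewrite !in_itv/= -!ler_norml.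
Qed.

Lemma square_max W (A : R) : 0 <= A ->
  continuous (fun p : R * R => W p.1 p.2) ->
  exists s t, [/\ `|s| <= A, `|t| <= A &
    forall s' t', `|s'| <= A -> `|t'| <= A -> W s' t' <= W s t].
Proof.
move=> A0 cW.
have [||[s t]] := @compact_EVT_max _ _ (fun p : R * R => W p.1 p.2) _ _ (@compact_square A).
- by exists (0, 0); rewrite /= normr0.
- exact: continuous_subspaceT.
rewrite inE/= => -[hs ht] H; exists s, t; split=> // s' t' hs' ht'.
by apply: (H (s', t')); rewrite inE.
Qed.

Lemma is_derive_sqr_shift (e k x : R) :
  is_derive x 1 (fun y => e * (y ^+ 2 + k)) (e * (2 * x)).
Proof.
have -> : (fun y => e * (y ^+ 2 + k)) = cst e * (id ^+ 2 + cst k).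
  by apply/funext => y; rewrite /= !fctE.
by apply: is_derive_eq; rewrite /GRing.scale/= expr1 addr0 mulr0 addr0 mulr1.
Qed.

(** If W exceeded M somewhere, then W + e (s^2 + t^2) would, for a small e > 0,
    have its maximum over the square at an interior point where W > M; but there
    its Laplacian is at least 4 e > 0, against the second derivative test.
    Subharmonicity matters only where W > M. *)
Lemma max_principle W (A M : R) : 0 < A ->
  continuous (fun p : R * R => W p.1 p.2) ->
  (forall s t, `|s| <= A -> `|t| <= A -> `|s| = A \/ `|t| = A -> W s t <= M) ->
  (forall s t, `|s| < A -> `|t| < A -> M < W s t -> subharmonic_at W s t) ->
  forall s t, `|s| <= A -> `|t| <= A -> W s t <= M.
Proof.
move=> A0 cW bd sub s0 t0 hs0 ht0; rewrite leNgt; apply/negP => WM.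
have A2 : 0 < A ^+ 2 by rewrite exprn_gt0.
(* e (s^2 + t^2) <= 2 e A^2 is half of the excess W s0 t0 - M on the square. *)
pose e := (W s0 t0 - M) / (4 * A ^+ 2).
have e0 : 0 < e by rewrite divr_gt0 ?mulr_gt0//; lra.
have eE : e * A ^+ 2 * 4 = W s0 t0 - M by rewrite /e; field; rewrite gt_eqF.
pose F s t := W s t + e * (s ^+ 2 + t ^+ 2).
have sq s : `|s| <= A -> s ^+ 2 <= A ^+ 2.
  by move=> ?; rewrite -[s ^+ 2]real_normK ?num_real// lerXn2r ?nnegrE// ltW.
have cF : continuous (fun p : R * R => F p.1 p.2).
  move=> p; apply: (@continuousD _ _ _ (fun p : R * R => W p.1 p.2)); first exact: cW.
  apply: (@continuousM _ _ (cst e)); first exact: cst_continuous.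
  apply: (@continuousD _ _ _ (fun p : R * R => p.1 ^+ 2) (fun p : R * R => p.2 ^+ 2)).
    by apply: (@continuousM _ _ (fun p : R * R => p.1) (fun p => p.1)); exact: cvg_fst.
  by apply: (@continuousM _ _ (fun p : R * R => p.2) (fun p => p.2)); exact: cvg_snd.
have [s1 [t1 [hs1 ht1 Fmax]]] := square_max (ltW A0) cF.
have W1 : M < W s1 t1.
  have := Fmax _ _ hs0 ht0; rewrite /F.
  have := sq _ hs1; have := sq _ ht1.
  have := sqr_ge0 s0; have := sqr_ge0 t0.
  move: eE; nra.
have is1 : `|s1| < A.
  rewrite lt_neqAle hs1 andbT; apply/eqP => E.
  by have := bd _ _ hs1 ht1 (or_introl E); lra.
have it1 : `|t1| < A.
  rewrite lt_neqAle ht1 andbT; apply/eqP => E.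
  by have := bd _ _ hs1 ht1 (or_intror E); lra.
have [Wx [Wy [wxx [wyy [D1 D2 D3 D4 pos]]]]] := sub _ _ is1 it1 W1.
have nearA (x : R) : `|x| < A -> \forall y \near x, `|y| <= A.
  move=> xA; have : (Num.norm : R -> R) @ x --> `|x| by exact: norm_continuous.
  move/(cvgr_lt `|x|)/(_ _ xA); apply: filterS => y; exact: ltW.
have D2e (x : R) : is_derive x 1 (fun y => e * (2 * y)) (2 * e).
  have -> : (fun y => e * (2 * y)) = cst (e * 2) * id.
    by apply/funext => y; rewrite /= !fctE mulrA.
  by apply: is_derive_eq; rewrite /GRing.scale/= mulr1 mulr0 addr0 mulrC.
have xx : wxx + 2 * e <= 0.
  apply: (@second_derivative_test (F^~ t1) (fun s => Wx s + e * (2 * s)) s1).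
  - move: D1; apply: filterS => s D.
    exact: (is_deriveD D (is_derive_sqr_shift e (t1 ^+ 2) s)).
  - by apply: filterS (nearA _ is1) => s hs; exact: Fmax.
have yy : wyy + 2 * e <= 0.
  apply: (@second_derivative_test (F s1) (fun t => Wy t + e * (2 * t)) t1).
  - move: D3; apply: filterS => t D.
    rewrite (_ : F s1 = W s1 + (fun t => e * (t ^+ 2 + s1 ^+ 2))); last first.
      by apply/funext => y; rewrite /F [s1 ^+ 2 + _]addrC.
    exact: (is_deriveD D (is_derive_sqr_shift e (s1 ^+ 2) t)).
  - by apply: filterS (nearA _ it1) => t ht; exact: Fmax.
lra.
Qed.

End planar.

(** * The identity theorem for holomorphic functions of one variable *)

Section cauchy_riemann.
Variable R : realType.
Implicit Types (s t : R) (u v a b : R -> R -> R) (D : R -> R -> Prop).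

(** The function u + iv has complex derivative a + ib at the points of D. *)
Definition has_cderiv D u v a b := forall s t, D s t ->
  [/\ is_derive s 1 (u^~ t) (a s t), is_derive t 1 (u s) (- b s t),
      is_derive s 1 (v^~ t) (b s t) & is_derive t 1 (v s) (a s t)].

(** Two complex derivatives are required, so that the Laplacian of |u + iv|^2
    makes sense without knowing that one derivative implies all of them. *)
Definition holo D u v := exists a b c d, has_cderiv D u v a b /\ has_cderiv D a b c d.

Lemma has_cderivM D u v a b u' v' a' b' : has_cderiv D u v a b -> has_cderiv D u' v' a' b' ->
  has_cderiv D (fun s t => u s t * u' s t - v s t * v' s t)
       (fun s t => u s t * v' s t + v s t * u' s t)
       (fun s t => (u s t * a' s t - v s t * b' s t) +
                   (a s t * u' s t - b s t * v' s t))
       (fun s t => (u s t * b' s t + v s t * a' s t) +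
                   (a s t * v' s t + b s t * u' s t)).
Proof.
move=> H H' s t Dst; have [h1 h2 h3 h4] := H s t Dst.
have [k1 k2 k3 k4] := H' s t Dst; split.
- apply: is_deriveB_eq (is_deriveM_eq h1 k1 erefl) (is_deriveM_eq h3 k3 erefl) _; ring.
- apply: is_deriveB_eq (is_deriveM_eq h2 k2 erefl) (is_deriveM_eq h4 k4 erefl) _; ring.
- apply: is_deriveD_eq (is_deriveM_eq h1 k3 erefl) (is_deriveM_eq h3 k1 erefl) _; ring.
- apply: is_deriveD_eq (is_deriveM_eq h2 k4 erefl) (is_deriveM_eq h4 k2 erefl) _; ring.
Qed.

Lemma has_cderivD D u v a b u' v' a' b' : has_cderiv D u v a b -> has_cderiv D u' v' a' b' ->
  has_cderiv D (fun s t => u s t + u' s t) (fun s t => v s t + v' s t)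
       (fun s t => a s t + a' s t) (fun s t => b s t + b' s t).
Proof.
move=> H H' s t Dst; have [h1 h2 h3 h4] := H s t Dst.
have [k1 k2 k3 k4] := H' s t Dst; split.
- exact: is_deriveD_eq h1 k1 erefl.
- by apply: is_deriveD_eq h2 k2 _; rewrite opprD.
- exact: is_deriveD_eq h3 k3 erefl.
- exact: is_deriveD_eq h4 k4 erefl.
Qed.

Lemma holo_mul D u v u' v' : holo D u v -> holo D u' v' ->
  holo D (fun s t => u s t * u' s t - v s t * v' s t)
         (fun s t => u s t * v' s t + v s t * u' s t).
Proof.
move=> [a [b [c [d [h1 h2]]]]] [a' [b' [c' [d' [k1 k2]]]]].
do 4 eexists; split; first exact: has_cderivM h1 k1.
by apply: has_cderivD; [exact: has_cderivM h1 k2|exact: has_cderivM h2 k1].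
Qed.

Definition punctured s t := s ^+ 2 + t ^+ 2 != 0.

Lemma is_derive_sqrD (x k : R) :
  is_derive x 1 (fun y => y ^+ 2 + k) (2 * x).
Proof.
rewrite (_ : (fun y => _) = (fun y => 1 * (y ^+ 2 + k))).
  by have := is_derive_sqr_shift 1 k x; rewrite mul1r.
by apply/funext => y; rewrite mul1r.
Qed.

Lemma is_derive_inv_sqrD (x k : R) : x ^+ 2 + k != 0 ->
  is_derive x 1 (fun y => (y ^+ 2 + k)^-1) (- (2 * x) * (x ^+ 2 + k) ^- 2).
Proof.
move=> nz; have D := is_derive_sqrD x k.
apply: DeriveDef; first by apply: derivableV => //; case: D.
rewrite deriveV//.
by rewrite derive_val /GRing.scale/=; ring.
Qed.

(** The derivative of 1/z is -1/z^2. *)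
Lemma has_cderivV : has_cderiv punctured (fun s t => s * (s ^+ 2 + t ^+ 2)^-1)
  (fun s t => - t * (s ^+ 2 + t ^+ 2)^-1)
  (fun s t => (t ^+ 2 - s ^+ 2) * (s ^+ 2 + t ^+ 2) ^- 2)
  (fun s t => 2 * s * t * (s ^+ 2 + t ^+ 2) ^- 2).
Proof.
move=> s t nz.
have Ds := is_derive_inv_sqrD nz.
have Dt : is_derive t 1 (fun y => (s ^+ 2 + y ^+ 2)^-1)
    (- (2 * t) * (s ^+ 2 + t ^+ 2) ^- 2).
  rewrite (_ : (fun y => _) = (fun y => (y ^+ 2 + s ^+ 2)^-1)); last first.
    by apply/funext => y; rewrite addrC.
  by rewrite [s ^+ 2 + _]addrC; apply: is_derive_inv_sqrD; rewrite addrC.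
have Dc (x y : R) : is_derive x 1 (fun=> y) 0 by exact: is_derive_cst.
have Di (x : R) : is_derive x 1 (fun y : R => y) 1 by exact: is_derive_id.
have Dn (x : R) : is_derive x 1 (fun y : R => - y) (- 1).
  exact: (is_deriveN (Di x)).
split.
- by apply: is_deriveM_eq (Di s) Ds _; field.
- by apply: is_deriveM_eq (Dc t s) Dt _; field.
- by apply: is_deriveM_eq (Dc s (- t)) Ds _; field.
- by apply: is_deriveM_eq (Dn t) Dt _; field.
Qed.

(** The second derivative comes from the product rule applied to -1/z * 1/z. *)
Lemma holo_inv : holo punctured (fun s t => s * (s ^+ 2 + t ^+ 2)^-1)
  (fun s t => - t * (s ^+ 2 + t ^+ 2)^-1).
Proof.
have Dc (x y : R) : is_derive x 1 (fun=> y) 0 by exact: is_derive_cst.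
have minus1 : has_cderiv punctured (fun _ _ => -1) (fun _ _ => 0)
    (fun _ _ => 0) (fun _ _ => 0).
  by move=> s t _; rewrite oppr0; split; exact: Dc.
do 4 eexists; split; first exact: has_cderivV.
have := has_cderivM minus1 (has_cderivM has_cderivV has_cderivV).
set a := (X in has_cderiv _ X _ _ _); set b := (X in has_cderiv _ _ X _ _).
rewrite (_ : a = (fun s t => (t ^+ 2 - s ^+ 2) * (s ^+ 2 + t ^+ 2) ^- 2)); last first.
  by apply/funext => s; apply/funext => t; rewrite /a -!exprVn; ring.
rewrite (_ : b = (fun s t => 2 * s * t * (s ^+ 2 + t ^+ 2) ^- 2)); last first.
  by apply/funext => s; apply/funext => t; rewrite /b -!exprVn; ring.
exact.
Qed.

(** The Laplacian of |f|^2 is 4 |f'|^2. *)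
Lemma holo_subharmonic D u v s t : holo D u v ->
  (\forall s' \near s, D s' t) -> (\forall t' \near t, D s t') ->
  subharmonic_at (fun s t => u s t ^+ 2 + v s t ^+ 2) s t.
Proof.
move=> [a [b [c [d [h k]]]]] Ds Dt.
have [k1 k2 k3 k4] := k s t (nbhs_singleton Ds).
have [h1 h2 h3 h4] := h s t (nbhs_singleton Ds).
exists (fun s => 2 * (u s t * a s t + v s t * b s t)).
exists (fun t => 2 * (v s t * a s t - u s t * b s t)).
exists (2 * (a s t ^+ 2 + b s t ^+ 2 + u s t * c s t + v s t * d s t)).
exists (2 * (a s t ^+ 2 + b s t ^+ 2 - u s t * c s t - v s t * d s t)).
have Dc (x y : R) : is_derive x 1 (fun=> y) 0 by exact: is_derive_cst.
split.
- apply: filterS Ds => x Dx; have [g1 _ g3 _] := h x t Dx.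
  by apply: is_deriveD_eq (is_deriveM_eq g1 g1 erefl) (is_deriveM_eq g3 g3 erefl) _; ring.
- apply: is_deriveM_eq (Dc s 2)
    (is_deriveD_eq (is_deriveM_eq h1 k1 erefl) (is_deriveM_eq h3 k3 erefl) erefl) _.
  ring.
- apply: filterS Dt => y Dy; have [_ g2 _ g4] := h s y Dy.
  by apply: is_deriveD_eq (is_deriveM_eq g2 g2 erefl) (is_deriveM_eq g4 g4 erefl) _; ring.
- apply: is_deriveM_eq (Dc t 2)
    (is_deriveB_eq (is_deriveM_eq h4 k2 erefl) (is_deriveM_eq h2 k4 erefl) erefl) _.
  ring.
- have := sqr_ge0 (a s t); have := sqr_ge0 (b s t); lra.
Qed.

Lemma punctured_near s t : punctured s t ->
  (\forall s' \near s, punctured s' t) /\ (\forall t' \near t, punctured s t').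
Proof.
have P x y : punctured x y = (x != 0) || (y != 0).
  by rewrite /punctured paddr_eq0 ?sqr_ge0// !sqrf_eq0 negb_and.
have neq0_near (x : R) : x != 0 -> \forall y \near x, y != 0.
  by move=> x0; exact: (@cvgr_neq0 R R R (nbhs x) _ (fun y : R => y) x (@cvg_id _ _) x0).
rewrite P => /orP[s0|t0]; split.
- by apply: filterS (neq0_near _ s0) => x x0; rewrite P x0.
- by near=> y; rewrite P s0.
- by near=> x; rewrite P t0 orbT.
- by apply: filterS (neq0_near _ t0) => x x0; rewrite P x0 orbT.
Unshelve. all: by end_near.
Qed.

(** The function f / z^n is holomorphic off the origin and its squared modulus is
    |f|^2 / |z|^(2n); at the origin, both sides are governed by 0^-1 = 0. *)
Lemma holo_div_pow u v n : holo punctured u v ->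
  exists un vn, holo punctured un vn /\ forall s t,
    un s t ^+ 2 + vn s t ^+ 2 = (u s t ^+ 2 + v s t ^+ 2) * (s ^+ 2 + t ^+ 2) ^- n.
Proof.
move=> h; elim: n => [|n [un [vn [hn En]]]].
  by exists u, v; split=> // s t; rewrite expr0 invr1 mulr1.
do 2 eexists; split; first exact: holo_mul hn holo_inv.
move=> s t /=; rewrite [(s ^+ 2 + t ^+ 2) ^+ n.+1]exprSr invfM [RHS]mulrA -En.
have [r0|r0] := eqVneq (s ^+ 2 + t ^+ 2) 0; first by rewrite r0 invr0; ring.
by field.
Qed.

Lemma geometric_le0 (q B x : R) : 0 <= q < 1 -> (forall n, x <= B * q ^+ n) -> x <= 0.
Proof.
move=> /andP[q0 q1] H.
have : (fun n => B * q ^+ n) @ \oo --> B * 0.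
  by apply: cvgM; [exact: cvg_cst|apply: cvg_expr; rewrite ger0_norm].
rewrite mulr0 => C; rewrite -(cvg_lim _ C)//.
apply: limr_ge; first by apply/cvg_ex; exists 0.
by near=> n; apply: H.
Unshelve. all: by end_near.
Qed.

(** If f vanishes near 0, then f / z^n extends by 0 to a function whose squared
    modulus satisfies the maximum principle on the square of half-side A. Since
    |z| >= A on its boundary, |f(z)|^2 <= B (|z|^2 / A^2)^n for every n, where B
    bounds |f|^2. Letting n grow gives f(z) = 0 as soon as |z| < A. *)
Lemma holo_identity u v (dl : R) : 0 < dl -> holo punctured u v ->
  continuous (fun p : R * R => u p.1 p.2) ->
  continuous (fun p : R * R => v p.1 p.2) ->
  (forall s t, `|s| < dl -> `|t| < dl -> u s t = 0 /\ v s t = 0) ->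
  forall s t, u s t = 0 /\ v s t = 0.
Proof.
move=> dl0 h cu cv z s0 t0.
pose N s t := u s t ^+ 2 + v s t ^+ 2.
pose r2 s t := s ^+ 2 + t ^+ 2.
have N0 s t : 0 <= N s t by rewrite addr_ge0 ?sqr_ge0.
have csq (f : R * R -> R) : continuous f -> continuous (fun p => f p ^+ 2).
  by move=> cf p; apply: (@continuousM _ _ f f); exact: cf.
have cN : continuous (fun p : R * R => N p.1 p.2).
  move=> p; apply: (@continuousD _ _ _ (fun p : R * R => u p.1 p.2 ^+ 2)
    (fun p : R * R => v p.1 p.2 ^+ 2)); [exact: (csq _ cu)|exact: (csq _ cv)].
have cr : continuous (fun p : R * R => r2 p.1 p.2).
  move=> p; apply: (@continuousD _ _ _ (fun p : R * R => p.1 ^+ 2)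
    (fun p : R * R => p.2 ^+ 2)); apply: csq => q; [exact: cvg_fst|exact: cvg_snd].
(* Any A with s0^2 + t0^2 < A^2 would do. *)
pose A := `|s0| + `|t0| + 1.
have A0 : 0 < A by rewrite /A; have := normr_ge0 s0; have := normr_ge0 t0; lra.
have [s1 [t1 [_ _ Bmax]]] := square_max (ltW A0) cN.
have A2 : 0 < A ^+ 2 by rewrite exprn_gt0.
have sqA s : `|s| = A -> s ^+ 2 = A ^+ 2 by move=> <-; rewrite real_normK ?num_real.
have N00 : N 0 0 = 0.
  have [|| u0 v0] := z 0 0; rewrite ?normr0//.
  by rewrite /N u0 v0 expr0n/= addr0.
have r0P s t : ~~ punctured s t -> s = 0 /\ t = 0.
  rewrite /punctured negbK paddr_eq0 ?sqr_ge0// !sqrf_eq0.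
  by move=> /andP[/eqP-> /eqP->].
have bnd n s t : `|s| <= A -> `|t| <= A ->
    N s t * r2 s t ^- n <= N s1 t1 * (A ^+ 2) ^- n.
  apply: (@max_principle _ (fun s t => N s t * r2 s t ^- n)) => //.
  - move=> [s' t']; have [p|] := boolP (punctured s' t').
      apply: (@continuousM _ _ (fun p : R * R => N p.1 p.2) (fun p => r2 p.1 p.2 ^- n)).
        exact: cN.
      apply: cvgV; first by rewrite expf_neq0.
      by apply: (@continuous_comp _ _ _ (fun p => r2 p.1 p.2) (fun y => y ^+ n));
        [exact: cr|exact: exprn_continuous].
    move=> /r0P[-> ->]; rewrite /continuous_at/= N00 mul0r.
    apply: cvg_near_cst.
    exists (ball 0 dl, ball 0 dl) => /=.
      by split; exact: nbhsx_ballx.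
    move=> -[x y] /=; rewrite /ball/= !sub0r !normrN => -[hx hy].
    by rewrite /N; have [-> ->] := z _ _ hx hy; rewrite expr0n/= addr0 mul0r.
  - move=> s' t' hs ht hA.
    have Ar : A ^+ 2 <= r2 s' t'.
      by case: hA => /sqA E; rewrite /r2 E ?lerDl ?lerDr ?sqr_ge0.
    have rp : 0 < r2 s' t' by apply: lt_le_trans Ar.
    apply: ler_pM; rewrite ?invr_ge0 ?exprn_ge0 ?(ltW rp)//; first exact: Bmax.
    by rewrite lef_pV2 ?posrE ?exprn_gt0// lerXn2r // nnegrE ltW.
  - move=> s' t' _ _ Wp.
    have p : punctured s' t'.
      have [//|/r0P[E1 E2]] := boolP (punctured s' t').
      move: Wp; rewrite E1 E2 N00 mul0r ltNge.
      by rewrite mulr_ge0// invr_ge0 exprn_ge0// ltW.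
    have [un [vn [hn En]]] := holo_div_pow n h.
    rewrite (_ : (fun s t => _) = (fun s t => un s t ^+ 2 + vn s t ^+ 2)).
      by have [ps pt] := punctured_near p; exact: holo_subharmonic hn ps pt.
    by apply/funext => x; apply/funext => y; rewrite En.
suff : N s0 t0 <= 0.
  rewrite le_eqVlt ltNge N0 orbF /N paddr_eq0 ?sqr_ge0// !sqrf_eq0.
  by move=> /andP[/eqP-> /eqP->].
have [p|/r0P[-> ->]] := boolP (punctured s0 t0); last by rewrite N00.
have rp : 0 < r2 s0 t0 by rewrite lt_neqAle eq_sym addr_ge0 ?sqr_ge0// andbT.
apply: (@geometric_le0 (r2 s0 t0 / A ^+ 2) (N s1 t1)).
  rewrite divr_ge0 ?ltW//= ltr_pdivrMr// mul1r /r2 /A.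
  rewrite -[s0 ^+ 2]real_normK ?num_real// -[t0 ^+ 2]real_normK ?num_real//.
  have := normr_ge0 s0; have := normr_ge0 t0; nra.
move=> n; have := bnd n s0 t0.
rewrite ler_pdivrMr ?exprn_gt0// expr_div_n mulrA mulrAC; apply; rewrite /A.
  by have := normr_ge0 t0; lra.
by have := normr_ge0 s0; lra.
Qed.

End cauchy_riemann.

(** * Cauchy-Riemann and Laplace equations in a pair of coordinates *)

Section slices.
Variables (R : realType) (n : nat).
Implicit Types (f p q w : 'rV[R]_n.+1 -> R) (x : 'rV[R]_n.+1) (i j : 'I_n.+1).
Local Notation e i := (delta_mx 0 i : 'rV[R]_n.+1).

(** The restriction of f to the plane through x spanned by two coordinate
    directions. *)
Definition slice f x i j : R -> R -> R := fun s t => f (x + s *: e i + t *: e j).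

Lemma slice_deriv1 f x i j (s t : R) : smooth f ->
  is_derive s 1 ((slice f x i j)^~ t) (slice (partial i f) x i j s t).
Proof.
move=> sf; have := smooth_line i (x + t *: e j) s sf.
rewrite /slice addrAC (_ : (fun h : R => _) = (fun s0 => f (x + s0 *: e i + t *: e j)))//.
by apply/funext => h; rewrite addrAC.
Qed.

Lemma slice_deriv2 f x i j (s t : R) : smooth f ->
  is_derive t 1 (slice f x i j s) (slice (partial j f) x i j s t).
Proof. by move=> sf; exact: (smooth_line j (x + s *: e i) t sf). Qed.

Lemma slice_continuous f x i j : smooth f ->
  continuous (fun z : R * R => slice f x i j z.1 z.2).
Proof.
move=> /smooth_continuous cf z.
apply: (@continuous_comp _ _ _ (fun z : R * R => x + z.1 *: e i + z.2 *: e j) f);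
  last exact: cf.
apply: cvgD; first apply: cvgD; first exact: cvg_cst.
  by apply: cvgZr_tmp; exact: cvg_fst.
by apply: cvgZr_tmp; exact: cvg_snd.
Qed.

Lemma slice00 f x i j : slice f x i j 0 0 = f x.
Proof. by rewrite /slice !scale0r !addr0. Qed.

Definition cauchy_riemann_eq p q i j :=
  forall x, partial i p x = partial j q x /\ partial j p x = - partial i q x.

Lemma cauchy_riemann_slice D p q x i j : smooth p -> smooth q -> cauchy_riemann_eq p q i j ->
  has_cderiv D (slice p x i j) (slice q x i j)
       (slice (partial i p) x i j) (slice (partial i q) x i j).
Proof.
move=> sp sq cr s t _; have [c1 c2] := cr (x + s *: e i + t *: e j); split.
- exact: slice_deriv1.
- by rewrite /slice -c2; exact: slice_deriv2.
- exact: slice_deriv1.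
- by rewrite [X in is_derive _ _ _ X]c1; exact: slice_deriv2.
Qed.

(** The derivative of a holomorphic function is holomorphic; here this is the
    symmetry of second derivatives. *)
Lemma cauchy_riemann_partial p q i j : smooth p -> smooth q -> cauchy_riemann_eq p q i j ->
  cauchy_riemann_eq (partial i p) (partial i q) i j.
Proof.
move=> sp sq cr x.
have E1 : partial i p = partial j q by apply/funext => y; case: (cr y).
have E2 : partial j p = (fun y => - partial i q y) by apply/funext => y; case: (cr y).
split; first by rewrite E1 (partialC i j).
rewrite (partialC j i)// E2.
have := smooth_is_derive i x (smooth_partial i sq) => D.
by have [_ <-] := is_deriveN D.
Qed.

Lemma cauchy_riemann_identity p q x i j (dl : R) : 0 < dl ->
  smooth p -> smooth q -> cauchy_riemann_eq p q i j ->
  (forall s t : R, `|s| < dl -> `|t| < dl ->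
     slice p x i j s t = 0 /\ slice q x i j s t = 0) ->
  forall s t, slice p x i j s t = 0 /\ slice q x i j s t = 0.
Proof.
move=> dl0 sp sq cr; apply: holo_identity => //; try exact: slice_continuous.
do 4 eexists; split; first exact: cauchy_riemann_slice.
by apply: cauchy_riemann_slice; [exact: smooth_partial..|exact: cauchy_riemann_partial].
Qed.

(** The maximum principle on a large square bounds w and -w by 0. *)
Lemma harmonic_compact_support w i j : smooth w ->
  (forall x, partial i (partial i w) x + partial j (partial j w) x = 0) ->
  (forall x, exists2 A : R, 0 < A &
     forall s t, `|s| = A \/ `|t| = A -> slice w x i j s t = 0) ->
  forall x, w x = 0.
Proof.
move=> sw lap bd x; have [A A0 wA] := bd x.
have signed (c : R) : c * w x <= 0.
  rewrite -(slice00 w x i j).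
  apply: (@max_principle _ (fun s t => c * slice w x i j s t) A) => //.
  - move=> z; apply: (@continuousM _ _ (cst c) (fun z => slice w x i j z.1 z.2)).
      exact: cst_continuous.
    exact: slice_continuous.
  - by move=> s t _ _ /wA ->; rewrite mulr0.
  - move=> s t _ _ _.
    have D1 (f : R -> R) (y df : R) : is_derive y 1 f df ->
        is_derive y 1 (fun z => c * f z) (c * df).
      move=> Df; apply: is_deriveM_eq (is_derive_cst c y 1) Df _.
      by rewrite mulr0 addr0.
    exists (fun s => c * slice (partial i w) x i j s t).
    exists (fun t => c * slice (partial j w) x i j s t).
    exists (c * slice (partial i (partial i w)) x i j s t).
    exists (c * slice (partial j (partial j w)) x i j s t).
    split.
    + by near=> s'; apply: D1; exact: slice_deriv1.
    + by apply: D1; apply: slice_deriv1; exact: smooth_partial.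
    + by near=> s'; apply: D1; exact: slice_deriv2.
    + by apply: D1; apply: slice_deriv2; exact: smooth_partial.
    + by rewrite -mulrDr /slice lap mulr0.
  - by rewrite normr0 ltW.
  - by rewrite normr0 ltW.
have := signed 1; have := signed (-1); lra.
Unshelve. all: by end_near.
Qed.

(** The function f = p + iq is holomorphic in z = x_i + i x_j and lies on the
    real line p = h q, which turns with the point as h_i = 1. Writing g for 1 + h^2, the
    equations become g q_j = q and g q_i = - h q. Differentiating the first along
    i and the second along j and subtracting cancels the second derivatives and
    leaves q_i = h q_j; with the first order equations this gives h q = 0. *)
Lemma local_vanishing p q h i j (O : set 'rV[R]_n.+1) :
  smooth p -> smooth q -> smooth h -> cauchy_riemann_eq p q i j ->
  (forall x, partial i h x = 1) -> (forall x, partial j h x = 0) ->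
  open O -> (forall x, O x -> p x = h x * q x) ->
  forall x, O x -> h x != 0 -> q x = 0.
Proof.
move=> sp sq sh cr h1 h0 Oopen pE x Ox hx.
have dq k y : is_derive y (e k) q (partial k q y) by exact: smooth_is_derive.
have dh k y : is_derive y (e k) h (partial k h y) by exact: smooth_is_derive.
have dpE k y : O y -> partial k p y = h y * partial k q y + q y * partial k h y.
  move=> Oy; have -> : partial k p y = partial k (fun z => h z * q z) y.
    apply: near_eq_partial; apply: filterS (open_nbhs_nbhs (conj Oopen Oy)).
    exact: pE.
  by have [_ <-] := is_deriveM_eq (dh k y) (dq k y) erefl.
have grad y : O y -> (1 + h y * h y) * partial j q y - q y = 0 /\
    (1 + h y * h y) * partial i q y + h y * q y = 0.
  move=> Oy; have [] := cr y; rewrite !dpE// h1 h0 mulr1 mulr0 addr0.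
  set a := partial i q y; set b := partial j q y => E1 E2.
  have Ea : a = - (h y * b) by rewrite E2 opprK.
  have Eq : q y = b + h y * h y * b by move: E1; rewrite Ea; lra.
  by rewrite Eq Ea; split; ring.
have D2 k y : is_derive y (e k) (fun z => 1 + h z * h z)
    (2 * h y * partial k h y).
  have D1 : is_derive y (e k) (fun=> 1 : R) 0 by exact: is_derive_cst.
  have D2 : is_derive y (e k) (fun z => h z * h z) (2 * h y * partial k h y).
    by apply: (is_deriveM_eq (dh k y) (dh k y)); ring.
  by apply: (is_deriveD_eq D1 D2); rewrite add0r.
have dqq k l y : is_derive y (e k) (partial l q) (partial k (partial l q) y).
  by apply: smooth_is_derive; exact: smooth_partial.
have Onear : nbhs x O by exact: open_nbhs_nbhs.
have zero k (f : 'rV[R]_n.+1 -> R) df : is_derive x (e k) f df ->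
    (forall y, O y -> f y = 0) -> df = 0.
  move=> [_ <-] f0; have := @near_eq_partial _ _ f (cst 0) k x.
  rewrite /partial derive_cst; apply.
  by apply: filterS Onear => y /f0.
have := zero i _ _ (is_deriveB_eq (is_deriveM_eq (D2 i x) (dqq i j x) erefl)
  (dq i x) erefl) (fun y Oy => (grad y Oy).1).
have := zero j _ _ (is_deriveD_eq (is_deriveM_eq (D2 j x) (dqq j i x) erefl)
  (is_deriveM_eq (dh j x) (dq j x) erefl) erefl) (fun y Oy => (grad y Oy).2).
rewrite (partialC i j)// h1 h0 !mulr0 addr0 mulr1.
have [] := grad x Ox.
move: (partial j (partial i q) x) (partial j q x) (partial i q x) (q x) (h x) hx.
move=> qij qj qi q0 h' h'0 g1 g2 e1 e2.
have qiE : qi = h' * qj by lra.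
have q0E : q0 = (1 + h' * h') * qj by lra.
have : h' * ((1 + h' * h') * qj) = 0 by move: g2; rewrite q0E qiE; lra.
by rewrite -q0E => /eqP; rewrite mulf_eq0 (negPf h'0) => /eqP.
Qed.

End slices.

(** * The almost complex structure *)

Local Notation o0 := (@Ordinal 4 0 isT).
Local Notation o1 := (@Ordinal 4 1 isT).
Local Notation o2 := (@Ordinal 4 2 isT).
Local Notation o3 := (@Ordinal 4 3 isT).

Section structure.
Variable R : realType.
Implicit Types (x y : 'rV[R]_4) (a : 'rV[R]_4 -> 'M[R]_4).

Local Notation e i := (delta_mx 0 i : 'rV[R]_4).

Lemma ord4P (P : 'I_4 -> Prop) : P o0 -> P o1 -> P o2 -> P o3 -> forall i, P i.
Proof.
by move=> p0 p1 p2 p3 [[|[|[|[|//]]]] H];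
  [move: p0|move: p1|move: p2|move: p3]; congr (P _); apply: val_inj.
Qed.

Lemma sum4 (F : 'I_4 -> R) : \sum_(i < 4) F i = F o0 + F o1 + F o2 + F o3.
Proof.
rewrite !big_ord_recr/= big_ord0 add0r.
by congr (F _ + F _ + F _ + F _); apply: val_inj.
Qed.

Definition sqnorm x : R := x 0 o0 * x 0 o0 + x 0 o1 * x 0 o1 +
  (x 0 o2 * x 0 o2 + x 0 o3 * x 0 o3).

Definition cutoff x : R := flat 0 (1 + -1 * sqnorm x).

(** The slope must vary with the point for the relation p = slope * q to force
    p + iq = 0; the shift by 2 keeps it away from 0 on the unit ball. *)
Definition slope x : R := x 0 o0 + 2.

(** The structure whose (1,0)-forms are spanned by dz1 and dz2 + g d(conj z1)
    with 2 g = P + iQ; row k is the image of the k-th coordinate vector. *)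
Definition perturbedJ_rows (P Q : R) : seq (seq R) :=
  [:: [:: 0; 1; -1 * Q; P];
      [:: -1; 0; P; Q];
      [:: 0; 0; 0; 1];
      [:: 0; 0; -1; 0]].

Definition perturbedJmx (P Q : R) : 'M[R]_4 :=
  \matrix_(i, j) nth 0 (nth [::] (perturbedJ_rows P Q) i) j.

Definition perturbedJ x : 'M[R]_4 := perturbedJmx (cutoff x) (cutoff x * slope x).

Lemma perturbedJmx_sqr P Q : perturbedJmx P Q *m perturbedJmx P Q = - 1%:M.
Proof.
apply/matrixP => i j; rewrite !mxE sum4 !mxE.
move: i j; apply: ord4P; apply: ord4P; rewrite /= ?mulr0n ?mulr1n; ring.
Qed.

Lemma perturbedJmx_std : perturbedJmx 0 0 = std_J R.
Proof.
apply/matrixP => i j.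
have -> : std_J R i j = (e i *m std_J R) 0 j by rewrite -rowE [RHS]mxE.
rewrite -[e i *m _]toC2K std_JE !mxE.
move: i j; apply: ord4P; apply: ord4P => /=.
all: rewrite -?val_eqE /= ?inordK //=; ring.
Qed.

Lemma form_evalE (A : 'M[R]_4) (u v : 'rV[R]_4) :
  form_eval A u v = \sum_(l < 4) (\sum_(k < 4) u 0 k * A k l) * v 0 l.
Proof. by rewrite /form_eval !mxE; apply: eq_bigr => l _; rewrite !mxE. Qed.

Lemma elementary_sqnorm : elementary sqnorm.
Proof. by repeat first [apply: elementaryD|apply: elementaryM|apply: elementary_coord]. Qed.

Lemma elementary_cutoff : elementary cutoff.
Proof.
apply: elementary_flat; apply: elementaryD; first exact: elementary_cst.
by apply: elementaryM; [exact: elementary_cst|exact: elementary_sqnorm].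
Qed.

Lemma elementary_slope : elementary slope.
Proof. by apply: elementaryD; [exact: elementary_coord|exact: elementary_cst]. Qed.

Lemma perturbedJ_almost_complex : almost_complex perturbedJ.
Proof.
split=> [i j|x]; last exact: perturbedJmx_sqr.
apply: elementary_smooth.
rewrite (_ : (fun x => _) = fun x =>
    nth 0 (nth [::] (perturbedJ_rows (cutoff x) (cutoff x * slope x)) i) j);
  last by apply/funext => x; rewrite mxE.
have eb := elementary_cutoff; have es := elementary_slope.
move: i j; apply: ord4P; apply: ord4P => /=;
  by repeat first [exact: eb|exact: es|apply: elementary_cst|apply: elementaryM].
Qed.

Lemma cutoff_out x i : 1 < `|x 0 i| -> cutoff x = 0.
Proof.
move=> xi; apply: flat_le0.
suff : 1 <= sqnorm x by lra.
have xi2 : 1 <= x 0 i * x 0 i.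
  have : `|x 0 i| * `|x 0 i| = x 0 i * x 0 i by rewrite -normrM ger0_norm// -expr2 sqr_ge0.
  by nra.
have sq k : 0 <= x 0 k * x 0 k by rewrite -expr2 sqr_ge0.
have := sq o0; have := sq o1; have := sq o2; have := sq o3; rewrite /sqnorm.
by move: i {xi} xi2; apply: ord4P; lra.
Qed.

Lemma perturbedJ_std_outside : exists K : set 'rV[R]_4,
  compact K /\ forall x, ~ K x -> perturbedJ x = std_J R.
Proof.
exists [set x | forall i, x ord0 i \in `[(-1 : R), 1]]; split.
  apply: (@rV_compact _ _ (fun=> `[(-1 : R), 1]%classic)).
  by move=> _; exact: segment_compact.
move=> x /existsNP[i /negP]; rewrite in_itv/= -ler_norml -ltNge => /cutoff_out b0.
by rewrite /perturbedJ b0 mul0r perturbedJmx_std.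
Qed.

(** Anti-invariance on pairs of coordinate vectors leaves two free components:
    with f = u + iv, u = a x o0 o2 and v = - a x o0 o3, the form is the real part
    of f dz1 /\ (dz2 + g d(conj z1)), so that its (x1, y1)-component is
    Im (2 f g). *)
Lemma anti_invariant_components a x : (forall x, (a x)^T = - a x) ->
  anti_invariant perturbedJ a ->
  [/\ a x o2 o3 = 0, a x o1 o3 = - a x o0 o2, a x o1 o2 = a x o0 o3
    & a x o0 o1 = cutoff x * (slope x * a x o0 o2 - a x o0 o3)].
Proof.
move=> skew anti.
have sk i j : a x j i = - a x i j.
  by have := congr1 (fun M : 'M[R]_4 => M i j) (skew x); rewrite !mxE.
have cst_smooth i : smooth_mx (fun _ : 'rV[R]_4 => e i).
  by move=> k l; apply: elementary_smooth; exact: elementary_cst.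
have H i j := anti _ _ (cst_smooth i) (cst_smooth j) x.
have {}H i j :
    \sum_(l < 4) (\sum_(k < 4) perturbedJ x i k * a x k l) * perturbedJ x j l
    = - a x i j.
  have := H i j; rewrite form_evalE -!rowE.
  rewrite /form_eval trmx_delta -colE -rowE [in RHS]mxE [in RHS]mxE => <-.
  apply: eq_bigr => l _; rewrite [row _ _ _ _]mxE; congr (_ * _).
  by apply: eq_bigr => k _; rewrite [row _ _ _ _]mxE.
have d i : a x i i = 0 by have := sk i i; lra.
have := H o2 o3; have := H o0 o2; have := H o0 o3; have := H o0 o1.
rewrite !sum4 !mxE /= !d (sk o0 o1) (sk o0 o2) (sk o0 o3) (sk o1 o2) (sk o1 o3) (sk o2 o3).
move: (cutoff x) (slope x) (a x o0 o1) (a x o0 o2) (a x o0 o3) (a x o1 o2)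
  (a x o1 o3) (a x o2 o3).
move=> P h a01 a02 a03 a12 a13 a23 E1 E2 E3 E4.
have e23 : a23 = 0 by lra.
have e13 : a13 = - a02 by move: E3; rewrite e23; lra.
have e12 : a12 = a03 by move: E2; rewrite e23; lra.
by split=> //; move: E1; rewrite e23 e13 e12; lra.
Qed.

End structure.

(** * Vanishing of the closed anti-invariant forms *)

Section vanishing.
Variable R : realType.
Implicit Types (x y : 'rV[R]_4) (a : 'rV[R]_4 -> 'M[R]_4) (p q : 'rV[R]_4 -> R).

Local Notation e i := (delta_mx 0 i : 'rV[R]_4).

Lemma partial_slope k x : partial k (@slope R) x = (e k) 0 o0.
Proof.
have D2 : is_derive x (e k) (fun=> 2 : R) 0 by exact: is_derive_cst.
by have [_ <-] := is_deriveD_eq (is_derive_coord o0 x (e k)) D2 (addr0 _).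
Qed.

Lemma open_unit_ball : open [set x : 'rV[R]_4 | sqnorm x < 1].
Proof.
apply: (@open_comp _ _ (@sqnorm R) [set z | z < 1]); last exact: open_lt.
by move=> x _; apply: smooth_continuous; apply: elementary_smooth; exact: elementary_sqnorm.
Qed.

(** The identity theorem is used first in the z2-planes that meet the ball near
    its centre, then in all z1-planes, each of which contains points reached by
    the first step. *)
Lemma vanishing_from_ball p q : smooth p -> smooth q ->
  cauchy_riemann_eq p q o0 o1 -> cauchy_riemann_eq p q o2 o3 ->
  (forall x, sqnorm x < 1 -> p x = 0 /\ q x = 0) ->
  forall x, p x = 0 /\ q x = 0.
Proof.
move=> sp sq cr01 cr23 z.
have half0 : 0 < 1 / 2 :> R by lra.
have sqh (c : R) : `|c| < 1 / 2 -> c * c < 1 / 4.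
  move=> hc; have : `|c| * `|c| = c * c by rewrite -normrM ger0_norm// -expr2 sqr_ge0.
  by have := normr_ge0 c; nra.
have step1 x : `|x 0 o0| < 1 / 2 -> `|x 0 o1| < 1 / 2 -> p x = 0 /\ q x = 0.
  move=> x0 x1; pose y := x - x 0 o2 *: e o2 - x 0 o3 *: e o3.
  have := @cauchy_riemann_identity _ _ p q y o2 o3 _ half0 sp sq cr23 _ (x 0 o2) (x 0 o3).
  rewrite /slice /y addrAC subrK subrK; apply=> s t hs ht; apply: z.
  rewrite /sqnorm !mxE /=.
  rewrite !(mulr0, subr0, addr0, mulr1) !subrr !add0r.
  have := sqh _ x0; have := sqh _ x1; have := sqh _ hs; have := sqh _ ht; lra.
move=> x; pose y := x - x 0 o0 *: e o0 - x 0 o1 *: e o1.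
have := @cauchy_riemann_identity _ _ p q y o0 o1 _ half0 sp sq cr01 _ (x 0 o0) (x 0 o1).
rewrite /slice /y addrAC subrK subrK; apply=> s t hs ht.
by apply: step1; rewrite !mxE /= !(mulr0, subr0, addr0, mulr1) subrr add0r.
Qed.

(** With p and q the (x1, y2)- and (x1, x2)-components of the form and w its
    (x1, y1)-component, closedness says that p + iq is holomorphic in z2 and that
    the failure of holomorphy in z1 is measured by the z2-gradient of w.
    Differentiating, w is harmonic in z2; as a multiple of the cutoff it has
    compact support, so it vanishes. Then p + iq is holomorphic in z1 as well,
    and p = slope * q on the unit ball. *)
Lemma closed_anti_invariant_eq0 a : closed_anti_invariant (@perturbedJ R) a -> a = 0.
Proof.
move=> [[sa skew] closed anti].
have sk i j x : a x j i = - a x i j.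
  by have := congr1 (fun M : 'M[R]_4 => M i j) (skew x); rewrite !mxE.
have [p [sp Ep]] : exists p, smooth p /\ forall x, a x o0 o3 = p x.
  exact: (ex_intro _ _ (conj (sa o0 o3) (fun=> erefl))).
have [q [sq Eq]] : exists q, smooth q /\ forall x, a x o0 o2 = q x.
  exact: (ex_intro _ _ (conj (sa o0 o2) (fun=> erefl))).
have [w [sw Ew]] : exists w, smooth w /\ forall x, a x o0 o1 = w x.
  exact: (ex_intro _ _ (conj (sa o0 o1) (fun=> erefl))).
have comp x : [/\ a x o2 o3 = 0, a x o1 o3 = - q x, a x o1 o2 = p x
    & w x = cutoff x * (slope x * q x - p x)].
  by rewrite -Ew -Eq -Ep; exact: anti_invariant_components.
have E01 : (fun x => a x o0 o1) = w by apply/funext.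
have E02 : (fun x => a x o0 o2) = q by apply/funext.
have E23 : (fun x => a x o2 o3) = (fun=> 0) by apply/funext => x; case: (comp x).
have E13 : (fun x => a x o1 o3) = (fun x => - q x) by apply/funext => x; case: (comp x).
have E12 : (fun x => a x o1 o2) = p by apply/funext => x; case: (comp x).
have E31 : (fun x => a x o3 o1) = q.
  by apply/funext => x; rewrite (sk o1 o3); have [_ -> _ _] := comp x; rewrite opprK.
have E30 : (fun x => a x o3 o0) = (fun x => - p x).
  by apply/funext => x; rewrite (sk o0 o3) Ep.
have E20 : (fun x => a x o2 o0) = (fun x => - q x).
  by apply/funext => x; rewrite (sk o0 o2) Eq.
have C123 x : partial o2 q x + partial o3 p x = 0.
  by have := closed o1 o2 o3 x; rewrite /ext_deriv E23 E31 E12 partial0 add0r.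
have C023 x : - partial o2 p x + partial o3 q x = 0.
  by have := closed o0 o2 o3 x; rewrite /ext_deriv E23 E30 E02 partial0 add0r partialN.
have C012 x : partial o0 p x - partial o1 q x + partial o2 w x = 0.
  by have := closed o0 o1 o2 x; rewrite /ext_deriv E12 E20 E01 partialN.
have C013 x : - partial o0 q x - partial o1 p x + partial o3 w x = 0.
  by have := closed o0 o1 o3 x; rewrite /ext_deriv E13 E30 E01 !partialN.
have cr23 : cauchy_riemann_eq p q o2 o3.
  move=> x; split; last exact: esym (addr0_eq (C123 x)).
  by rewrite -(addr0_eq (C023 x)) opprK.
have lap x : partial o2 (partial o2 w) x + partial o3 (partial o3 w) x = 0.
  have -> : partial o2 w = (fun y => partial o1 q y - partial o0 p y).
    by apply/funext => y; rewrite -(addr0_eq (C012 y)) opprB.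
  have -> : partial o3 w = (fun y => partial o0 q y + partial o1 p y).
    by apply/funext => y; rewrite -(addr0_eq (C013 y)) opprD !opprK.
  rewrite partialB ?partialD; try exact: smooth_partial.
  rewrite (partialC o2 o1)// (partialC o2 o0)// (partialC o3 o0)// (partialC o3 o1)//.
  have -> : partial o2 q = (fun y => - partial o3 p y).
    by apply/funext => y; rewrite -(addr0_eq (C123 y)) opprK.
  have -> : partial o3 q = partial o2 p.
    by apply/funext => y; rewrite -(addr0_eq (C023 y)) opprK.
  rewrite partialN; last exact: smooth_partial.
  by rewrite -opprD [X in _ + X]addrC addNr.
have w_out y i : 1 < `|y 0 i| -> w y = 0.
  by move=> /cutoff_out b0; have [_ _ _ ->] := comp y; rewrite b0 mul0r.
have w0 x : w x = 0.
  apply: (harmonic_compact_support sw lap) => {}x.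
  (* On the boundary of this square, a coordinate exceeds 1 in absolute value. *)
  exists (`|x 0 o2| + `|x 0 o3| + 2).
    by have := normr_ge0 (x 0 o2); have := normr_ge0 (x 0 o3); lra.
  move=> s t [] hA.
  - apply: (w_out _ o2); rewrite !mxE /= mulr0 addr0 mulr1.
    have := ler_normB (x 0 o2 + s) (x 0 o2); rewrite [_ + s - _]addrAC subrr add0r hA.
    by have := normr_ge0 (x 0 o3); lra.
  - apply: (w_out _ o3); rewrite !mxE /= mulr0 addr0 mulr1.
    have := ler_normB (x 0 o3 + t) (x 0 o3); rewrite [_ + t - _]addrAC subrr add0r hA.
    by have := normr_ge0 (x 0 o2); lra.
have w_cst : w = (fun=> 0) by apply/funext.
have cr01 : cauchy_riemann_eq p q o0 o1.
  move=> x; have := C012 x; have := C013 x; rewrite w_cst !partial0.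
  rewrite !addr0 => E1 E0; split; first exact: subr0_eq.
  by apply: oppr_inj; exact: esym (addr0_eq E1).
have in_ball x : sqnorm x < 1 -> p x = 0 /\ q x = 0.
  have pE y : sqnorm y < 1 -> p y = slope y * q y.
    move=> ys; have [_ _ _] := comp y; rewrite w0 => /esym/eqP.
    rewrite mulf_eq0 gt_eqF/=; last by apply: flat_gt0; lra.
    by rewrite subr_eq0 => /eqP.
  move=> xs; suff q0 : q x = 0 by split=> //; rewrite pE// q0 mulr0.
  apply: (@local_vanishing _ _ p q (@slope R) o0 o1 [set y | sqnorm y < 1]) => //.
  - by apply: elementary_smooth; exact: elementary_slope.
  - by move=> y; rewrite partial_slope mxE.
  - by move=> y; rewrite partial_slope mxE.
  - exact: open_unit_ball.
  - move: xs; rewrite /sqnorm /slope /= => xs; rewrite gt_eqF//.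
    have := sqr_ge0 (x 0 o1); have := sqr_ge0 (x 0 o2); have := sqr_ge0 (x 0 o3).
    rewrite !expr2; nra.
have pq := vanishing_from_ball sp sq cr01 cr23 in_ball.
apply/funext => x; apply/matrixP => i j; rewrite [RHS]mxE.
have [p0 q0] := pq x; have [h23 h13 h12 _] := comp x.
have d k : a x k k = 0 by have := sk k k x; lra.
move: i j; apply: ord4P; apply: ord4P;
  rewrite ?d ?(sk o0 o1) ?(sk o0 o2) ?(sk o0 o3) ?(sk o1 o2) ?(sk o1 o3)
    ?(sk o2 o3) ?Ew ?Eq ?Ep ?h12 ?h13 ?h23 ?w0 ?p0 ?q0 ?oppr0 //.
Qed.

End vanishing.

Theorem corollary3p9 (R : realType) :
  exists J : 'rV[R]_4 -> 'M[R]_4,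
    [/\ almost_complex J,
        exists K : set 'rV[R]_4,
          compact K /\ forall x, ~ K x -> J x = std_J R
      & h_minus_eq J 0].
Proof.
exists (@perturbedJ R).
split; [exact: perturbedJ_almost_complex|exact: perturbedJ_std_outside|].
exists (fun=> 0); split=> [c _ []//|a]; split=> [|[c ->]].
  by move=> /closed_anti_invariant_eq0 ->; exists (fun=> 0); rewrite big_ord0.
rewrite big_ord0; split.
- split=> [i j|x]; last by apply/matrixP => i j; rewrite !mxE oppr0.
  apply: elementary_smooth; rewrite (_ : (fun x => _) = fun=> 0).
    exact: elementary_cst.
  by apply/funext => x; rewrite mxE.
- move=> i j k x; rewrite /ext_deriv.
  have Z l m : (fun y => (0 : 'rV[R]_4 -> 'M[R]_4) y l m) = (fun=> 0).
    by apply/funext => y; rewrite mxE.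
  by rewrite !Z !partial0 !addr0.
- move=> X Y _ _ x.
  by rewrite /form_eval !mulmx0 !mul0mx !mxE oppr0.
Qed.
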